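(* For all integers $n\geq 2$, $B(n)-B(n-1)\in\{0,1\}$. In other words, the sequence $(B(n))_{n\geq 1}$ is slow.
   Context: The sequence $(B(n))_{n\geq1}$ of positive integers is defined by the initial conditions $B(1)=1$, $B(2)=2$, $B(3)=3$, $B(4)=4$, $B(5)=5$ and, for $n\geq 6$, the nested recurrence $$B(n)=B(n-B(n-1))+B(n-B(n-2))+B(n-B(n-3)).$$ A priori, $B(n)$ is defined only if the three arguments on the right are all indices in $\{1,\dots,n-1\}$ at which $B$ is defined; an assertion about $B(n)$ for all $n$ includes that $B(n)$ is defined for all $n$. A sequence is called slow if it is infinite, monotone (weakly) increasing, and each successive difference is $0$ or $1$. *)

(* Defs.v *)
From mathcomp Require Import all_boot all_order all_algebra.

Set Implicit Arguments.
Unset Strict Implicit.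
Unset Printing Implicit Defensive.

Local Open Scope nat_scope.

(* [B_graph n v] : B(n) is defined and equals v.  Being an inductive predicate,
   it is the least relation closed under the clauses, so B(n) has a value
   exactly when the recursive evaluation succeeds; B(0) never has one.
   [n - a] is truncated, but the guards [0 < n - a < n] hold exactly when the
   integer n - a is an index in {1, ..., n-1}. *)
Inductive B_graph : nat -> nat -> Prop :=
| B_graph1 : B_graph 1 1
| B_graph2 : B_graph 2 2
| B_graph3 : B_graph 3 3
| B_graph4 : B_graph 4 4
| B_graph5 : B_graph 5 5
| B_graph_rec (n a b c x y z : nat) :
    6 <= n ->
    B_graph (n - 1) a -> B_graph (n - 2) b -> B_graph (n - 3) c ->
    0 < n - a < n -> 0 < n - b < n -> 0 < n - c < n ->
    B_graph (n - a) x -> B_graph (n - b) y -> B_graph (n - c) z ->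
    B_graph n (x + y + z).

(* Sequences are indexed from 1: the value of [s] at 0 is irrelevant.  The
   right-to-left direction says that B(n) is defined for every n >= 1, the
   other one that [s n] is its only value. *)
Definition is_B (s : nat -> nat) : Prop :=
  forall n v : nat, 1 <= n -> (B_graph n v <-> v = s n).

Definition unit_steps (s : nat -> nat) : Prop :=
  forall n : nat, 2 <= n ->
    ((s n)%:Z - (s (n - 1)%N)%:Z)%R \in [:: 0%R; 1%R].

(* Infinitude is carried by the type [nat -> nat]. *)
Definition slow (s : nat -> nat) : Prop :=
  (forall m n : nat, 1 <= m -> m <= n -> s m <= s n) /\ unit_steps s.

(* Main.v *)
Require Import Defs.
From mathcomp Require Import all_boot all_order all_algebra.
From mathcomp Require Import zify.

Set Implicit Arguments.
Unset Strict Implicit.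
Unset Printing Implicit Defensive.

Local Open Scope nat_scope.

(** The number of times [f v] that the sequence takes the value [v] can be
    given in closed form.  It satisfies, for k >= 2,
<<
      f (3k) = 2,     f (3k - 2) = 1,     f (3k - 1) = f k,
>>
    with f 1 = f 2 = f 3 = 1.  Since 2(3k - 1) - 1 = 3(2k - 1), the last
    equation says that [f v] depends only on the part of 2v - 1 prime to 3,
    which gives the explicit definition [freq] below.

    The sum [last_idx v] of the first [v] frequencies is the last index at which
    the value [v] occurs.  Adding the frequencies three by three
    ([last_idx_mul3]) yields last_idx (3k) = 3k + last_idx k - 1, and hence
    similar formulas at 3k - 1 and 3k - 2.  So if B n is one of 3k, 3k - 1,
    3k - 2, the indices n - B (n - i) for i = 1, 2, 3 all lie within distance 2
    of last_idx k, where the values of B are known from k and f k, and their sum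
    is B n in each case ([slowB_rec]).  Thus the sequence [slowB] having these
    frequencies, slow by construction, satisfies the nested recurrence; as the
    recurrence determines its solution, [slowB] is the sequence sought. *)

(** The frequency of the value [v]: 2 when the part of 2v - 1 prime to 3 is
    congruent to 2 modulo 3 and is not 5, and 1 otherwise.  The exception for 5
    accounts for the initial condition: 5 = 2 * 3 - 1, and the value 3 occurs
    only once. *)
Definition freq (v : nat) : nat :=
  let u := (v.*2.-1)`_(3^') in if (u %% 3 == 2) && (u != 5) then 2 else 1.

(** The last index at which the value [v] occurs. *)
Definition last_idx (v : nat) : nat := \sum_(1 <= u < v.+1) freq u.

(** The sequence that takes each value [v >= 1] exactly [freq v] times: it moves
    to the next value once the last index of the current one is passed.  It is 0
    at 0, so that value 1 starts at index 1. *)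
Fixpoint slowB (n : nat) : nat :=
  if n is m.+1 then
    if m.+1 <= last_idx (slowB m) then slowB m else (slowB m).+1
  else 0.

Lemma freq_bounds v : 1 <= freq v <= 2.
Proof. by rewrite /freq; case: ifP. Qed.

Lemma partn3'_id u : u %% 3 != 0 -> u`_(3^') = u.
Proof. by move=> u_mod; apply: part_pnat_id; rewrite p'natE. Qed.

Lemma freq_mul3 k : 1 < k -> freq (3 * k) = 2.
Proof. by move=> k_gt1; rewrite /freq partn3'_id; [case: ifP | ]; lia. Qed.

Lemma freq_mul3S k : freq (3 * k).+1 = 1.
Proof. by rewrite /freq partn3'_id; [case: ifP | ]; lia. Qed.

Lemma freq_mul3SS k : freq (3 * k).+2 = freq k.+1.
Proof.
rewrite /freq; have -> : ((3 * k).+2).*2.-1 = 3 * (k.+1).*2.-1 by lia.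
by rewrite partnM ?(@part_p'nat _ 3) ?mul1n //; lia.
Qed.

Lemma last_idx0 : last_idx 0 = 0.
Proof. by rewrite /last_idx big_geq. Qed.

Lemma last_idxS v : last_idx v.+1 = last_idx v + freq v.+1.
Proof. by rewrite /last_idx big_nat_recr. Qed.

Lemma last_idx_step v : last_idx v < last_idx v.+1 <= (last_idx v).+2.
Proof. by rewrite last_idxS; have := freq_bounds v.+1; lia. Qed.

Lemma leq_last_idx u v : u <= v -> last_idx u <= last_idx v.
Proof.
elim: v => [|v IHv]; first by case: u.
rewrite leq_eqVlt => /orP[/eqP-> //|]; rewrite ltnS => /IHv.
by have := last_idx_step v; lia.
Qed.

Lemma freq_small v : 0 < v <= 5 -> freq v = 1.
Proof.
case: v => [|[|[|[|[|[|]]]]]] // _; rewrite /freq /=.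
- by rewrite partn3'_id.
- by rewrite (@partnM _ 3 1) ?(@part_p'nat _ 3) ?partn1.
- by rewrite partn3'_id.
- by rewrite partn3'_id.
- by rewrite (@partnM _ 3 3) ?(@part_p'nat _ 3).
Qed.

Lemma last_idx_small v : v <= 5 -> last_idx v = v.
Proof.
elim: v => [|v IHv] v_le5; first exact: last_idx0.
by rewrite last_idxS freq_small; lia.
Qed.

Lemma last_idx_mul3 k : 0 < k -> (last_idx (3 * k)).+1 = 3 * k + last_idx k.
Proof.
case: k => // k _; elim: k => [|k IHk]; first by rewrite !last_idx_small.
have E : 3 * k.+2 = (3 * k.+1).+3 by lia.
have := @freq_mul3 k.+2 isT; rewrite E => freq3.
rewrite (last_idxS (3 * k.+1).+2) (last_idxS (3 * k.+1).+1) (last_idxS (3 * k.+1)).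
by rewrite (last_idxS k.+1) freq_mul3S freq_mul3SS freq3; lia.
Qed.

Lemma last_idx_mul3S k : 0 < k -> last_idx (3 * k).+1 = 3 * k + last_idx k.
Proof. by move/last_idx_mul3; rewrite last_idxS freq_mul3S; lia. Qed.

Lemma last_idx_mul3SS k :
  0 < k -> last_idx (3 * k).+2 = 3 * k + last_idx k.+1.
Proof.
by move/last_idx_mul3S; rewrite (last_idxS (3 * k).+1) freq_mul3SS (last_idxS k); lia.
Qed.

Lemma slowBS n :
  slowB n.+1 = if n.+1 <= last_idx (slowB n) then slowB n else (slowB n).+1.
Proof. by []. Qed.

(** The index [n.+1] is one of the indices allotted to its value. *)
Lemma slowB_bounds n :
  last_idx (slowB n.+1).-1 < n.+1 <= last_idx (slowB n.+1) /\ 0 < slowB n.+1.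
Proof.
elim: n => [|n IHn]; first by rewrite slowBS !last_idx_small.
rewrite slowBS; move: IHn; set v := slowB n.+1.
by case: ifP => //=; have := last_idx_step v; lia.
Qed.

Lemma slowB_eq n v : last_idx v < n <= last_idx v.+1 -> slowB n = v.+1.
Proof.
case: n => // n; have [] := slowB_bounds n; set w := slowB n.+1 => Hw w_gt0 Hv.
case: (ltngtP w v.+1) => // [w_lt|w_gt].
- by have := @leq_last_idx w v w_lt; lia.
- by have := @leq_last_idx v.+1 w.-1; lia.
Qed.

Lemma slowB_small n : n <= 5 -> slowB n = n.
Proof. by case: n => // n n_le; apply: slowB_eq; rewrite !last_idx_small; lia. Qed.

Lemma slowB_step n : slowB n <= slowB n.+1 <= (slowB n).+1.
Proof. by rewrite slowBS; case: ifP; lia. Qed.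

Lemma leq_slowB m n : m <= n -> slowB m <= slowB n.
Proof.
elim: n => [|n IHn]; first by case: m.
rewrite leq_eqVlt => /orP[/eqP-> //|]; rewrite ltnS => /IHn.
by have := slowB_step n; lia.
Qed.

Lemma slowB_gt0 n : 0 < n -> 0 < slowB n.
Proof. by case: n => // n _; case: (slowB_bounds n). Qed.

Lemma slowB_leq n : slowB n <= n.
Proof. by elim: n => // n; have := slowB_step n; lia. Qed.

(** The summand [slowB (n - slowB (n - i))] of the recurrence is [w.+1] as soon
    as [slowB (n - i)] is [a.+1], both values being certified by [last_idx]. *)
Lemma slowB_summand n i a w :
  last_idx a < n - i <= last_idx a.+1 ->
  last_idx w < n - a.+1 <= last_idx w.+1 ->
  slowB (n - slowB (n - i)) = w.+1.
Proof. by move=> /slowB_eq -> /slowB_eq. Qed.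

Lemma slowB_rec n : 6 <= n ->
  slowB n = slowB (n - slowB (n - 1)) + slowB (n - slowB (n - 2))
            + slowB (n - slowB (n - 3)).
Proof.
move=> n_ge6; have v_ge6 : 5 < slowB n.
  case: n n_ge6 => // n n_ge6; have [] := slowB_bounds n.
  set v := slowB n.+1 => Hv v_gt0; rewrite ltnNge; apply/negP => v_le5.
  by move: Hv; rewrite (@last_idx_small v) //; lia.
have: last_idx (slowB n).-1 < n <= last_idx (slowB n).
  by case: n n_ge6 {v_ge6} => // n _; case: (slowB_bounds n).
set v := slowB n in v_ge6 *; clearbody v.
(* The value [v] is [3k - 2], [3k - 1] or [3k] for [k = m.+2]. *)
have [m [r [r_lt3 def_v]]] : exists m r, r < 3 /\ v = 3 * m.+1 + r.+1.
  by exists (v.-1 %/ 3).-1, (v.-1 %% 3); lia.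
have S2 := @last_idx_mul3SS m.
have S3 := @last_idx_mul3 m.+1 isT; have S4 := @last_idx_mul3S m.+1 isT.
have S5 := @last_idx_mul3SS m.+1 isT; have S6 := @last_idx_mul3 m.+2 isT.
have E : 3 * m.+1 = (3 * m).+3 by lia.
have E' : 3 * m.+2 = (3 * m).+3.+3 by lia.
rewrite {}E {}E' in S3 S4 S5 S6 def_v; rewrite {}def_v {v} in v_ge6 *.
have T0 := last_idx_step m; have T1 := last_idx_step m.+1.
have T2 := last_idx_step m.+2; have T3 := last_idx_step (3 * m).+2.
(* [a_i.+1] is the value at [n - i] and [w_i.+1] the corresponding summand.
   They depend on the position of [n] among the indices with value [v] and,
   for [v = 3k], on the frequency of [k]. *)
have rec a1 w1 a2 w2 a3 w3 s :
    last_idx a1 < n - 1 <= last_idx a1.+1 ->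
    last_idx w1 < n - a1.+1 <= last_idx w1.+1 ->
    last_idx a2 < n - 2 <= last_idx a2.+1 ->
    last_idx w2 < n - a2.+1 <= last_idx w2.+1 ->
    last_idx a3 < n - 3 <= last_idx a3.+1 ->
    last_idx w3 < n - a3.+1 <= last_idx w3.+1 ->
    s = w1.+1 + w2.+1 + w3.+1 ->
    s = slowB (n - slowB (n - 1)) + slowB (n - slowB (n - 2))
        + slowB (n - slowB (n - 3)).
  by do 6![move=> ?]; rewrite (@slowB_summand n 1 a1 w1) //
    (@slowB_summand n 2 a2 w2) // (@slowB_summand n 3 a3 w3).
case: r r_lt3 v_ge6 => [|[|[|//]]] _; rewrite ?addnS ?addn0 /= => v_ge6 Hn.
- have m_gt0 : 0 < m by lia.
  have := S2 m_gt0; have := last_idx_mul3S m_gt0 => {}S2 S1.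
  by apply: (rec (3 * m).+2 m (3 * m).+2 m (3 * m).+1 m.+1); lia.
- have {}S2 : last_idx (3 * m).+2 = 3 * m + last_idx m.+1 by apply: S2; lia.
  have [def_n|def_n] : n = (last_idx (3 * m).+4).+1
                        \/ n = (last_idx (3 * m).+4).+2
    by lia.
    by apply: (rec (3 * m).+3 m (3 * m).+2 m.+1 (3 * m).+2 m.+1); lia.
  by apply: (rec (3 * m).+4 m (3 * m).+3 m.+1 (3 * m).+2 m.+1); lia.
have {T1} [freq_k|freq_k] : last_idx m.+2 = (last_idx m.+1).+1
                         \/ last_idx m.+2 = (last_idx m.+1).+2 by lia.
  have {Hn} [def_n|def_n] : n = last_idx (3 * m).+3.+3
                          \/ n.+1 = last_idx (3 * m).+3.+3
    by lia.
    by apply: (rec (3 * m).+3.+2 m (3 * m).+4 m.+1 (3 * m).+3 m.+2); lia.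
  by apply: (rec (3 * m).+4 m (3 * m).+3 m.+1 (3 * m).+2 m.+2); lia.
have {Hn} [def_n|def_n] : n = last_idx (3 * m).+3.+3
                          \/ n.+1 = last_idx (3 * m).+3.+3
  by lia.
  by apply: (rec (3 * m).+3.+2 m.+1 (3 * m).+4 m.+1 (3 * m).+4 m.+1); lia.
by apply: (rec (3 * m).+4 m.+1 (3 * m).+4 m.+1 (3 * m).+3 m.+1); lia.
Qed.

Lemma slowB_graph n : 0 < n -> B_graph n (slowB n).
Proof.
elim/ltn_ind: n => n IHn n_gt0; case: (leqP n 5) => [n_le5|n_gt5].
  rewrite slowB_small //; case: n n_gt0 n_le5 {IHn} => [|[|[|[|[|[|]]]]]] // _ _;
  by constructor.
have arg i : 0 < i <= 3 -> 0 < n - slowB (n - i) < n.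
  by move=> Hi; have := slowB_leq (n - i); have := @slowB_gt0 (n - i); lia.
have arg1 := arg 1 isT; have arg2 := arg 2 isT; have arg3 := arg 3 isT.
rewrite slowB_rec //.
apply: (@B_graph_rec n (slowB (n - 1)) (slowB (n - 2)) (slowB (n - 3))) => //;
  by apply: IHn; lia.
Qed.

Lemma slowB_is_B : is_B slowB.
Proof.
move=> n v n_gt0; split=> [|->]; last exact: slowB_graph.
elim=> {n v n_gt0} [|||||n a b c x y z n_ge6 _ -> _ -> _ -> _ _ _ _ -> _ -> _ ->];
  try by rewrite slowB_small.
by rewrite -slowB_rec.
Qed.

Lemma slowB_unit_steps : unit_steps slowB.
Proof.
case=> // n _; rewrite subn1 /= -/(slowB n.+1) !inE.
by have := slowB_step n; lia.
Qed.

Theorem theorem1 :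
  exists B : nat -> nat,
    is_B B /\
    (forall n : nat, 2 <= n ->
       ((B n)%:Z - (B (n - 1)%N)%:Z)%R \in [:: 0%R; 1%R]) /\
    slow B.
Proof.
exists slowB; split; first exact: slowB_is_B.
split; first exact: slowB_unit_steps.
by split; [move=> m n _; apply: leq_slowB | apply: slowB_unit_steps].
Qed.
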